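(* Let $n>1$ be an integer and let $\Gamma_{SD_{8n}}$ be the non-commuting graph of the semi-dihedral group $SD_{8n}=\langle a,b : a^{4n}=b^2=1,\ bab^{-1}=a^{2n-1}\rangle$ of order $8n$. Then: (a) $E(\Gamma_{SD_{8n}})<LE^+(\Gamma_{SD_{8n}})<LE(\Gamma_{SD_{8n}})$. (b) $\Gamma_{SD_{8n}}$ is neither hypoenergetic nor hyperenergetic. (c) $\Gamma_{SD_{8n}}$ is both Q-hyperenergetic and L-hyperenergetic.
   Context: For a finite non-abelian group $G$ with center $Z(G)$, the non-commuting graph $\Gamma_G$ is the simple undirected graph with vertex set $G\setminus Z(G)$ in which $x,y$ are adjacent iff $xy\ne yx$. For a finite simple graph $\mathcal G$ with vertex set $v(\mathcal G)$, edge set $e(\mathcal G)$, adjacency matrix $A(\mathcal G)$ and diagonal degree matrix $D(\mathcal G)$, put $L(\mathcal G)=D(\mathcal G)-A(\mathcal G)$ (Laplacian) and $Q(\mathcal G)=D(\mathcal G)+A(\mathcal G)$ (signless Laplacian). With sums over eigenvalues counted with multiplicity, define $E(\mathcal G)=\sum_{\lambda}|\lambda|$ ($\lambda$ eigenvalues of $A(\mathcal G)$), $LE(\mathcal G)=\sum_{\beta}\left|\beta-\frac{2|e(\mathcal G)|}{|v(\mathcal G)|}\right|$ ($\beta$ eigenvalues of $L(\mathcal G)$), $LE^+(\mathcal G)=\sum_{\gamma}\left|\gamma-\frac{2|e(\mathcal G)|}{|v(\mathcal G)|}\right|$ ($\gamma$ eigenvalues of $Q(\mathcal G)$). With $K_n$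 the complete graph on $n$ vertices, $\mathcal G$ is called hyperenergetic if $E(\mathcal G)>E(K_{|v(\mathcal G)|})$, hypoenergetic if $E(\mathcal G)<|v(\mathcal G)|$, L-hyperenergetic if $LE(\mathcal G)>LE(K_{|v(\mathcal G)|})$, and Q-hyperenergetic if $LE^+(\mathcal G)>LE^+(K_{|v(\mathcal G)|})$. *)

(* Defs.v *)
From HB Require Import structures.
From mathcomp Require Import all_boot all_order all_fingroup all_algebra.
From mathcomp Require Import all_solvable.

Set Implicit Arguments.
Unset Strict Implicit.
Unset Printing Implicit Defensive.

Import Order.TTheory GRing.Theory Num.Theory.
Local Open Scope ring_scope.

Record sgraph := SGraph {
  vertex : finType;
  adj : rel vertex;
  adj_sym : symmetric adj;
  adj_irrefl : irreflexive adj }.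

Definition edges (g : sgraph) : {set {set vertex g}} :=
  [set e | [exists x, exists y, adj x y && (e == [set x; y])]].

Definition nverts (g : sgraph) : nat := #|vertex g|.

Lemma complete_sym n : symmetric (fun i j : 'I_n => i != j).
Proof. by move=> i j; rewrite eq_sym. Qed.

Lemma complete_irrefl n : irreflexive (fun i j : 'I_n => i != j).
Proof. by move=> i; rewrite eqxx. Qed.

Definition complete_graph (n : nat) : sgraph :=
  SGraph (@complete_sym n) (@complete_irrefl n).

Section NonCommuting.
Variables (gT : finGroupType) (G : {group gT}).

Definition nc_vertex : finType := {x : gT | x \in (G :\: 'Z(G))%g}.

Definition nc_adj (x y : nc_vertex) : bool :=
  (val x * val y != val y * val x)%g.

Lemma nc_adj_sym : symmetric nc_adj.
Proof. by move=> x y; rewrite /nc_adj eq_sym. Qed.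

Lemma nc_adj_irrefl : irreflexive nc_adj.
Proof. by move=> x; rewrite /nc_adj eqxx. Qed.

Definition noncommuting_graph : sgraph := SGraph nc_adj_sym nc_adj_irrefl.

End NonCommuting.

(* Spectra are taken in an arbitrary algebraically closed numeric field C
   (for instance algC, or R[i] with R real closed). The order of C is partial,
   but sums of norms are nonnegative reals, so it is total on all the energies
   below, and negating a strict inequality has its usual meaning. *)
Section Energies.
Variable C : numClosedFieldType.

(* The roots of the characteristic polynomial, repeated with multiplicity
   (char_poly A is monic, so it is the product of the 'X - z%:P). *)
Definition eigenvalues (m : nat) (A : 'M[C]_m) : seq C :=
  sval (closed_field_poly_normal (char_poly A)).

Variable g : sgraph.

Definition adjacency_mx : 'M[C]_(nverts g) :=
  \matrix_(i, j) (adj (enum_val i : vertex g) (enum_val j))%:R.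

Definition degree_mx : 'M[C]_(nverts g) :=
  diag_mx (\row_i #|[set y | adj (enum_val i : vertex g) y]|%:R).

Definition laplacian_mx : 'M[C]_(nverts g) := degree_mx - adjacency_mx.

Definition signless_laplacian_mx : 'M[C]_(nverts g) :=
  degree_mx + adjacency_mx.

Definition average_degree : C := (2 * #|edges g|)%:R / (nverts g)%:R.

Definition energy : C := \sum_(l <- eigenvalues adjacency_mx) `|l|.

Definition laplacian_energy : C :=
  \sum_(b <- eigenvalues laplacian_mx) `|b - average_degree|.

Definition signless_laplacian_energy : C :=
  \sum_(c <- eigenvalues signless_laplacian_mx) `|c - average_degree|.

End Energies.

Definition hyperenergetic (C : numClosedFieldType) (g : sgraph) : bool :=
  energy C g > energy C (complete_graph (nverts g)).

Definition hypoenergetic (C : numClosedFieldType) (g : sgraph) : bool :=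
  energy C g < (nverts g)%:R.

Definition L_hyperenergetic (C : numClosedFieldType) (g : sgraph) : bool :=
  laplacian_energy C g > laplacian_energy C (complete_graph (nverts g)).

Definition Q_hyperenergetic (C : numClosedFieldType) (g : sgraph) : bool :=
  signless_laplacian_energy C g >
    signless_laplacian_energy C (complete_graph (nverts g)).

(* G is a semi-dihedral group SD_8n, given by its presentation; the latter
   defines a finite group, for which "\isog Grp" is genuine isomorphism. *)
Definition is_semidihedral (n : nat) (gT : finGroupType) (G : {group gT}) :=
  (G \isog Grp (a : b : (a ^+ (4 * n) = b ^+ 2 = 1,
                         b * a * b^-1 = a ^+ (2 * n - 1))))%g.

(* Main.v *)
Require Import Defs.
From mathcomp Require Import all_boot all_order all_fingroup all_algebra.
From mathcomp Require Import all_solvable.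
From mathcomp Require Import ring lra zify.

Set Implicit Arguments.
Unset Strict Implicit.
Unset Printing Implicit Defensive.

Import Order.TTheory GRing.Theory Num.Theory.
Local Open Scope ring_scope.

(** Modulo its centre, of order [z], the semi-dihedral group is dihedral with
    [m = 4n / z] rotations, and every non-central element has an abelian
    centralizer. Hence the non-commuting graph is complete multipartite: the
    non-central rotations form one part of size [(m - 1) z], and the
    reflections split into [m] parts of size [z], the cosets of the centre.

    For a complete multipartite graph, [D + s A] is a diagonal matrix constant
    on the parts, minus [s] times the block indicator of the parts, plus a
    rank-one matrix; applying det (1 + A B) = det (1 + B A) twice gives its
    characteristic polynomial. With one part of size [p] and [m] parts of size
    [z], all the eigenvalues are explicit up to one quadratic equation; the
    complete graph is the case [p = z = 1].

    For [p = (m - 1) z] the quadratic for [Q] contributes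
    [sqrt (z^2 + 8 p^2)], which lies between [2 p] and [3 p]; this is enough to
    show [E <= 2 (N - 1) < LE+ < LE], where [N] is the number of vertices and
    [2 (N - 1)] is each of the three energies of the complete graph. *)

(** * Determinants, polynomial identities and reindexing *)

(** Sylvester's identity: the two block triangular matrices in [e] are conjugate by the unipotent
    [L], and their determinants are the two sides. *)
Lemma det_1D_mulmxC (R : comNzRingType) m n (A : 'M[R]_(m, n)) (B : 'M_(n, m)) :
  \det (1%:M + A *m B) = \det (1%:M + B *m A).
Proof.
pose L := block_mx 1%:M 0 B 1%:M : 'M[R]_(m + n).
have e : block_mx (1%:M + A *m B) (- A) 0 1%:M *m L
       = L *m block_mx 1%:M (- A) 0 (1%:M + B *m A).
  rewrite !mulmx_block !(mul0mx, mulmx0, mul1mx, mulmx1, add0r, addr0).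
  by rewrite mulNmx mulmxN addrK addrCA addNr addr0.
have := congr1 determinant e.
by rewrite !det_mulmx !det_ublock !det_lblock !det1 !(mul1r, mulr1).
Qed.

(** Multiplying [p - q] by the linear factors at [bad] gives a polynomial that vanishes everywhere,
    in particular at more naturals than its degree. This lets a characteristic polynomial be
    computed by a formula with poles. *)
Lemma poly_eq_off_seq (F : numFieldType) (bad : seq F) (p q : {poly F}) :
  (forall x, x \notin bad -> p.[x] = q.[x]) -> p = q.
Proof.
move=> pq; pose r := (p - q) * \prod_(z <- bad) ('X - z%:P).
have r0 x : r.[x] = 0.
  rewrite hornerM; have [x_bad | /pq e] := boolP (x \in bad).
    suff /rootP-> : root (\prod_(z <- bad) ('X - z%:P)) x by rewrite mulr0.
    by rewrite root_prod_XsubC.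
  by rewrite hornerD hornerN e subrr mul0r.
apply/eqP; rewrite -subr_eq0; apply/eqP.
have /eqP : r = 0.
  apply: (@roots_geq_poly_eq0 _ r [seq i%:R | i <- iota 0 (size r)]).
  - by apply/allP => x _; apply/rootP.
  - by rewrite map_inj_uniq ?iota_uniq //; apply: mulrIn; apply: oner_neq0.
  - by rewrite size_map size_iota.
rewrite mulf_eq0 => /orP[/eqP // | /eqP b0].
by move: (monic_prod_XsubC bad predT id); rewrite b0 monicE lead_coef0 eq_sym oner_eq0.
Qed.

Lemma char_poly_horner (R : comNzRingType) n (A : 'M[R]_n) x :
  (char_poly A).[x] = \det (x%:M - A).
Proof.
rewrite -/(horner_eval x _) -det_map_mx; congr (\det _).
apply/matrixP=> i j.
rewrite /char_poly_mx !mxE /= /horner_eval.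
by rewrite hornerD hornerN hornerC hornerMn hornerX.
Qed.

Lemma reindex_enum_val (R : Type) (idx : R) (op : Monoid.com_law idx)
    (T : finType) (f : T -> R) :
  \big[op/idx]_(i < #|T|) f (enum_val i) = \big[op/idx]_v f v.
Proof.
rewrite [RHS](reindex_onto enum_val enum_rank) => [|v _]; last exact: enum_rankK.
by apply: eq_bigl => i; rewrite enum_valK eqxx.
Qed.

(** * Characteristic polynomial of a complete multipartite matrix *)

Section Multipartite.
Variables (F : fieldType) (T K : finType) (c : T -> K) (d : K -> F) (s : F).

Definition partsize k := #|[set v | c v == k]|.

(** Common form of the three matrices: [s] is 1 for the adjacency and signless Laplacian matrices
    and -1 for the Laplacian; [d] is zero or the degree, both constant on parts. *)
Definition multipartite_mx : 'M[F]_#|T| :=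
  \matrix_(i, j) (d (c (enum_val i)) *+ (i == j)
                  + s * (c (enum_val i) != c (enum_val j))%:R).

Variable x : F.
Hypothesis x_neq_d : forall k, x - d k != 0.
Hypothesis x_neq_ds : forall k, x - d k + s * (partsize k)%:R != 0.

(** [S] is the incidence matrix of vertices and parts, and [Sd] is [s] times the inverse of
    [diag_mx Dx] times [S]. The vector [w] is chosen so that [P *m w] is the all-ones vector for the
    matrix [P] below. *)
Let Dx : 'rV[F]_#|T| := \row_i (x - d (c (enum_val i))).
Let S : 'M[F]_(#|T|, #|K|) := \matrix_(i, k) (c (enum_val i) == enum_val k)%:R.
Let Sd : 'M[F]_(#|T|, #|K|) :=
  \matrix_(i, k) (s * (c (enum_val i) == enum_val k)%:R / (x - d (c (enum_val i)))).
Let w : 'cV[F]_#|T| :=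
  \col_i (x - d (c (enum_val i)) + s * (partsize (c (enum_val i)))%:R)^-1.

Let sum_part k (f : K -> F) :
  \sum_v (c v == k)%:R * f (c v) = (partsize k)%:R * f k.
Proof.
rewrite (eq_bigr (fun v => (c v == k)%:R * f k)); last first.
  by move=> v _; case: eqP => [-> // | _]; rewrite !mul0r.
by rewrite -mulr_suml -natr_sum /partsize cardsE -sum1_card [in RHS]big_mkcond.
Qed.

(** Sylvester's identity moves the determinant from vertices to parts, where [S^T *m Sd] is diagonal
    because the parts are disjoint. *)
Let det_parts : \det (diag_mx Dx *m (1%:M + Sd *m S^T)) =
  (\prod_v (x - d (c v))) * \prod_k (1 + s * (partsize k)%:R / (x - d k)).
Proof.
rewrite det_mulmx det_1D_mulmxC det_diag.
have -> : 1%:M + S^T *m Sd =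
    diag_mx (\row_k (1 + s * (partsize (enum_val k))%:R / (x - d (enum_val k)))).
  apply/matrixP=> k l; rewrite !mxE.
  under eq_bigr => i _ do rewrite !mxE.
  rewrite (reindex_enum_val _ (fun v => (c v == enum_val k)%:R *
     (s * (c v == enum_val l)%:R / (x - d (c v))))).
  rewrite (sum_part _ (fun j => s * (j == enum_val l)%:R / (x - d j))).
  rewrite (inj_eq enum_val_inj); case: eqP => [->|_] /=.
    by rewrite mulr1 !mulr1n mulrA [_ * s]mulrC.
  by rewrite !(mulr0, mul0r) addr0 !mulr0n.
rewrite det_diag; congr (_ * _).
  under eq_bigr => i _ do rewrite mxE.
  by rewrite (reindex_enum_val _ (fun v => x - d (c v))).
under eq_bigr => i _ do rewrite mxE.
by rewrite (reindex_enum_val _ (fun k => 1 + s * (partsize k)%:R / (x - d k))).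
Qed.

(** With [P] the diagonal part plus [s] times the block indicator and J the all-ones matrix, [x%:M]
    minus the matrix is P - sJ. Since [w] solves P w = 1, the factor [P] splits off and leaves a
    rank-one perturbation of the identity. *)
Lemma char_poly_multipartite_mx : (char_poly multipartite_mx).[x] =
  (\prod_v (x - d (c v))) * (\prod_k (1 + s * (partsize k)%:R / (x - d k)))
  * (1 - s * \sum_k (partsize k)%:R / (x - d k + s * (partsize k)%:R)).
Proof.
pose P := diag_mx Dx *m (1%:M + Sd *m S^T).
have Pij i j : P i j = (x - d (c (enum_val i))) *+ (i == j)
                       + s * (c (enum_val i) == c (enum_val j))%:R.
  rewrite /P mul_diag_mx !mxE mulrDr !mulr_natr; congr (_ + _); rewrite -mulr_natr.
  under eq_bigr => k _ do rewrite !mxE.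
  rewrite (bigD1 (enum_rank (c (enum_val j)))) //= enum_rankK eqxx mulr1.
  rewrite big1; first by rewrite addr0 mulrC divfK.
  move=> k kj; rewrite [c (enum_val j) == _]eq_sym.
  have [e | _] := eqVneq (enum_val k) (c (enum_val j)); last by rewrite mulr0.
  by rewrite -e enum_valK eqxx in kj.
have Pw : P *m w = const_mx 1.
  apply/colP=> i; rewrite !mxE.
  under eq_bigr => j _ do rewrite Pij !mxE mulrDl -mulrA.
  rewrite big_split /= -mulr_sumr (bigD1 i) //= eqxx big1 ?addr0; last first.
    by move=> j ji; rewrite [i == j]eq_sym (negPf ji) mul0r.
  rewrite (reindex_enum_val _ (fun v => (c (enum_val i) == c v)%:R *
    (x - d (c v) + s * (partsize (c v))%:R)^-1)).
  under eq_bigr => v _ do rewrite [c _ == c v]eq_sym.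
  rewrite (sum_part _ (fun k => (x - d k + s * (partsize k)%:R)^-1)) mulr1n.
  by rewrite mulrA -mulrDl divff.
rewrite char_poly_horner.
have -> : x%:M - multipartite_mx = P *m (1%:M + w *m (const_mx (- s) : 'rV_#|T|)).
  rewrite mulmxDr mulmx1 mulmxA Pw; apply/matrixP=> i j.
  rewrite [RHS]mxE Pij !mxE big_ord1 !mxE mul1r mulrnBl opprD !addrA.
  rewrite -[RHS]addrA; congr (_ + _).
  by case: eqP => _ /=; rewrite ?mulr0 ?mulr1 ?oppr0 ?add0r ?subrr.
rewrite det_mulmx det_parts; congr (_ * _).
rewrite det_1D_mulmxC det_mx11 !mxE eqxx; congr (_ + _).
under eq_bigr => i _ do rewrite !mxE mulNr.
rewrite sumrN -mulr_sumr; congr (- (_ * _)).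
rewrite (reindex_enum_val _ (fun v => (x - d (c v) + s * (partsize (c v))%:R)^-1)).
rewrite (partition_big c predT) //=; apply: eq_bigr => k _.
rewrite (eq_bigr (fun=> (x - d k + s * (partsize k)%:R)^-1)); last by move=> v /eqP->.
by rewrite /partsize -sum1dep_card natr_sum mulr_suml; apply: eq_bigr => v _; rewrite mul1r.
Qed.
End Multipartite.

(** [eigenvalues] is an unspecified factorization into linear factors, so its order is unknown;
    unique factorization fixes it up to permutation. *)
Lemma eigenvalues_perm (C : numClosedFieldType) m (A : 'M[C]_m) (r : seq C) :
  char_poly A = \prod_(z <- r) ('X - z%:P) -> perm_eq (eigenvalues A) r.
Proof.
rewrite /eigenvalues; case: closed_field_poly_normal => s /= es e.
by apply: prod_XsubC_eq; rewrite -e [RHS]es (monicP (char_poly_monic A)) scale1r.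
Qed.

(** * Spectrum with one part of size [p] and [m] parts of size [z] *)

Section TwoSizes.
Variables (C : numClosedFieldType) (T K : finType) (c : T -> K) (k0 : K).
Variables (p z m : nat) (s d0 d1 r1 r2 : C).
Hypotheses (p_gt0 : (0 < p)%N) (z_gt0 : (0 < z)%N) (m_gt0 : (0 < m)%N).
Hypotheses (cardK : #|K| = m.+1) (size_k0 : partsize c k0 = p).
Hypothesis size_k : forall k, k != k0 -> partsize c k = z.

Let d k : C := if k == k0 then d0 else d1.

Lemma card_two_sizes : #|T| = (p + m * z)%N.
Proof.
rewrite -sum1_card (partition_big c predT) //= (bigD1 k0) //=.
rewrite sum1dep_card -/(partsize c k0) size_k0; congr addn.
rewrite (eq_bigr (fun=> z)) => [|k kk0]; last by rewrite sum1dep_card; apply: size_k.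
by rewrite sum_nat_const cardC1 cardK.
Qed.

Let prod_K (g : K -> C) b : (forall k, k != k0 -> g k = b) ->
  \prod_k g k = g k0 * b ^+ m.
Proof.
move=> gb; rewrite (bigD1 k0) //= (eq_bigr (fun=> b)) //.
by rewrite prodr_const cardC1 cardK.
Qed.

Let sum_K (g : K -> C) b : (forall k, k != k0 -> g k = b) ->
  \sum_k g k = g k0 + b *+ m.
Proof.
move=> gb; rewrite (bigD1 k0) //= (eq_bigr (fun=> b)) //.
by rewrite sumr_const cardC1 cardK.
Qed.

(** Vectors with sum zero inside one part give [d0] and [d1]; vectors constant on the small parts,
    zero on the large one and of total sum zero give [d1 - s * z%:R]. The values [r1], [r2] have the
    trace and determinant of the 2 by 2 quotient matrix with rows d0, smz and sp, d1 + s(m-1)z. *)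
Lemma eigenvalues_two_sizes :
  r1 + r2 = d0 + (d1 - s * z%:R + s * m%:R * z%:R) ->
  r1 * r2 = d0 * (d1 - s * z%:R + s * m%:R * z%:R) - s ^+ 2 * (m * z * p)%:R ->
  perm_eq (eigenvalues (multipartite_mx c d s))
   (nseq p.-1 d0 ++ nseq (m * z.-1) d1 ++ nseq m.-1 (d1 - s * z%:R) ++ [:: r1; r2]).
Proof.
move=> r1Dr2 r1Mr2; apply: eigenvalues_perm.
(* The excluded points are the poles of the formula for the characteristic polynomial. *)
apply: (@poly_eq_off_seq _ [:: d0; d1; d0 - s * p%:R; d1 - s * z%:R]) => x.
rewrite !inE !negb_or -!(subr_eq0 x) !opprB !addrA.
rewrite ![x + _ * _ - _]addrAC => /and4P[x0 x1 x0p x1z].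
have xd k : x - d k != 0 by rewrite /d; case: ifP.
have xds k : x - d k + s * (partsize c k)%:R != 0.
  by rewrite /d; case: (eqVneq k k0) => [->|/size_k->]; rewrite ?size_k0.
rewrite char_poly_multipartite_mx // (partition_big c predT) //=.
rewrite (eq_bigr (fun k => (x - d k) ^+ partsize c k)); last first.
  move=> k _; rewrite (eq_bigr (fun=> x - d k)) => [|v /eqP-> //].
  by rewrite prodr_const /partsize cardsE.
rewrite (@prod_K _ ((x - d1) ^+ z)); last by move=> k kk; rewrite /d (negPf kk) size_k.
rewrite (@prod_K _ (1 + s * z%:R / (x - d1))); last first.
  by move=> k kk; rewrite /d (negPf kk) size_k.
rewrite (@sum_K _ (z%:R / (x - d1 + s * z%:R))); last first.
  by move=> k kk; rewrite /d (negPf kk) size_k.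
rewrite !size_k0 /d eqxx !big_cat /= !big_cons big_nil mulr1 !big_nseq !iter_mulr_1.
rewrite !hornerM !horner_exp !hornerXsubC.
have -> : (x - r1) * (x - r2) = x ^+ 2 - (r1 + r2) * x + r1 * r2 by ring.
rewrite r1Dr2 r1Mr2.
have -> : 1 + s * z%:R / (x - d1) = (x - d1 + s * z%:R) / (x - d1) by field.
have -> : x - (d1 - s * z%:R) = x - d1 + s * z%:R by ring.
(* Single factors are split off the powers to expose the multiplicities; the remaining powers are
   then generalized, which leaves [field] a rational identity. *)
rewrite -exprM expr_div_n -{1}(prednK z_gt0) mulSn exprD [(z.-1 * m)%N]mulnC.
rewrite -{1}(prednK p_gt0) exprSr -{3}(prednK m_gt0) exprSr.
have : (x - d1) ^+ m != 0 by rewrite expf_neq0.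
move: ((x - d1) ^+ m) ((x - d1) ^+ (m * z.-1)) ((x - d0) ^+ p.-1) => u v a u0.
move: ((x - d1 + s * z%:R) ^+ m.-1) => b.
rewrite !natrM -mulr_natr; field.
by rewrite x0 x0p x1z u0.
Qed.
End TwoSizes.

Lemma predn_natr (R : pzRingType) k : (0 < k)%N -> k.-1%:R = k%:R - 1 :> R.
Proof. by move=> k_gt0; rewrite -subn1 natrB. Qed.

(** * Complete multipartite graphs *)

(** Ordered adjacent pairs are counted by their underlying edge; each edge comes from exactly two of
    them. *)
Lemma handshake (g : sgraph) :
  (2 * #|edges g| = \sum_(x : vertex g) #|[set y | adj x y]|)%N.
Proof.
under eq_bigr => x _ do rewrite -sum1dep_card.
rewrite pair_big_dep /=.
rewrite (partition_big (fun u => [set u.1; u.2]) (mem (edges g))) /=; last first.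
  move=> [x y] /= xy; rewrite inE; apply/existsP; exists x; apply/existsP; exists y.
  by rewrite xy eqxx.
rewrite mulnC -sum_nat_const; apply: eq_bigr => e.
rewrite inE => /existsP[x /existsP[y /andP[xy /eqP->]]].
have x_neq_y : x != y by apply: contraTneq xy => ->; rewrite adj_irrefl.
rewrite sum1dep_card (_ : [set _ | _] = [set (x, y); (y, x)]).
  by rewrite cards2 xpair_eqE negb_and x_neq_y.
apply/setP=> [[a b]]; rewrite !inE !xpair_eqE /=; apply/andP/orP.
  case=> ab /eqP /setP e_ab.
  have : a != b by apply: contraTneq ab => ->; rewrite adj_irrefl.
  have := e_ab a; have := e_ab b; rewrite !inE !eqxx orbT /= => /esym bE /esym aE.
  by case/orP: aE bE => /eqP-> /orP[] /eqP->; rewrite !eqxx; [|left|right|].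
case=> /andP[/eqP-> /eqP->]; first by rewrite xy.
by rewrite adj_sym xy setUC.
Qed.

Section MultipartiteGraph.
Variables (C : numClosedFieldType) (g : sgraph) (K : finType).
Variables (c : vertex g -> K) (k0 : K) (p z m : nat).
Hypothesis adj_c : forall x y, adj x y = (c x != c y).
Hypotheses (p_gt0 : (0 < p)%N) (z_gt0 : (0 < z)%N) (m_gt0 : (0 < m)%N).
Hypotheses (cardK : #|K| = m.+1) (size_k0 : partsize c k0 = p).
Hypothesis size_k : forall k, k != k0 -> partsize c k = z.

Lemma nverts_multipartite : nverts g = (p + m * z)%N.
Proof. exact: card_two_sizes cardK size_k0 size_k. Qed.

Lemma degree_multipartite x :
  #|[set y | adj x y]| = if c x == k0 then (m * z)%N else (p + m.-1 * z)%N.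
Proof.
have : (partsize c (c x) + #|[set y | adj x y]| = nverts g)%N.
  rewrite /nverts /partsize -(cardsC [set v | c v == c x]); congr addn.
  by apply: eq_card => y; rewrite !inE adj_c eq_sym.
rewrite nverts_multipartite; case: eqP => [->|/eqP/size_k->]; rewrite ?size_k0; first by lia.
by rewrite -{1}(prednK m_gt0) mulSn; lia.
Qed.

Lemma edges_multipartite :
  (2 * #|edges g| = p * (m * z) + m * z * (p + m.-1 * z))%N.
Proof.
rewrite handshake; under eq_bigr => x _ do rewrite degree_multipartite.
rewrite (partition_big c predT) //= (bigD1 k0) //=.
rewrite (eq_bigr (fun=> m * z)%N) => [|v /eqP->]; last by rewrite eqxx.
rewrite sum_nat_cond_const -/(partsize c k0) size_k0; congr addn.
rewrite (eq_bigr (fun=> (z * (p + m.-1 * z))))%N => [|k kk0].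
  by rewrite sum_nat_const cardC1 cardK mulnA.
rewrite (eq_bigr (fun=> p + m.-1 * z)%N) => [|v /eqP->]; last by rewrite (negPf kk0).
by rewrite sum_nat_cond_const -/(partsize c k) size_k.
Qed.

Let deg k : C := if k == k0 then (m * z)%:R else (p + m.-1 * z)%:R.

(** The conditional with equal branches matches the shape of [d] in [eigenvalues_two_sizes]. *)
Lemma adjacency_multipartite :
  adjacency_mx C g = multipartite_mx c (fun k => if k == k0 then 0 else 0) 1.
Proof. by apply/matrixP=> i j; rewrite !mxE adj_c if_same mul0rn add0r mul1r. Qed.

Lemma laplacian_multipartite : laplacian_mx C g = multipartite_mx c deg (-1).
Proof.
apply/matrixP=> i j; rewrite !mxE degree_multipartite adj_c mulN1r /deg.
by case: ifP.
Qed.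

Lemma signless_laplacian_multipartite :
  signless_laplacian_mx C g = multipartite_mx c deg 1.
Proof.
apply/matrixP=> i j; rewrite !mxE degree_multipartite adj_c mul1r /deg.
by case: ifP.
Qed.

Lemma energy_multipartite r1 r2 :
  r1 + r2 = (m.-1 * z)%:R -> r1 * r2 = - (m * z * p)%:R ->
  energy C g = (m.-1 * z)%:R + `|r1| + `|r2|.
Proof.
move=> r1Dr2 r1Mr2; rewrite /energy adjacency_multipartite.
rewrite (perm_big _ (@eigenvalues_two_sizes _ _ _ c k0 p z m 1 0 0 r1 r2 _ _ _ _ _ _ _ _)) //=.
- rewrite !big_cat !big_nseq !iter_addr_0 !big_cons big_nil /= normr0 !mul0rn.
  rewrite sub0r mul1r normrN normr_nat addr0 !add0r addrA.
  by rewrite natrM mulr_natl.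
- by rewrite r1Dr2 natrM (predn_natr _ m_gt0); ring.
- by rewrite r1Mr2 expr1n; ring.
Qed.

Let avg := average_degree C g.

(** Here the quadratic has the roots 0 and the number of vertices; the latter equals [d1 + z], so
    its multiplicity rises from m - 1 to m. *)
Lemma laplacian_energy_multipartite :
  laplacian_energy C g = `|(m * z)%:R - avg| *+ p.-1
    + `|(p + m.-1 * z)%:R - avg| *+ (m * z.-1) + `|(nverts g)%:R - avg| *+ m + `|avg|.
Proof.
rewrite /laplacian_energy laplacian_multipartite.
rewrite (perm_big _ (@eigenvalues_two_sizes _ _ _ c k0 p z m (-1)
  (m * z)%:R (p + m.-1 * z)%:R (nverts g)%:R 0 _ _ _ _ _ _ _ _)) //=.
- rewrite !big_cat !big_nseq !iter_addr_0 !big_cons big_nil /= sub0r normrN.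
  rewrite addr0 !addrA -/avg; congr (_ + _).
  rewrite -!addrA; congr (_ + (_ + _)).
  rewrite mulN1r opprK addrA -natrD -addnA -mulSnr prednK // nverts_multipartite.
  by rewrite -mulrSr prednK.
- by rewrite nverts_multipartite !(natrD, natrM) (predn_natr _ m_gt0); ring.
- by rewrite !(natrD, natrM) (predn_natr _ m_gt0); ring.
Qed.

Lemma signless_laplacian_energy_multipartite r1 r2 :
  r1 + r2 = p%:R + (3 * m%:R - 2) * z%:R ->
  r1 * r2 = m%:R * z%:R * (2 * m%:R - 2) * z%:R ->
  signless_laplacian_energy C g = `|(m * z)%:R - avg| *+ p.-1
    + `|(p + m.-1 * z)%:R - avg| *+ (m * z.-1)
    + `|(p + m.-1 * z)%:R - z%:R - avg| *+ m.-1 + `|r1 - avg| + `|r2 - avg|.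
Proof.
move=> r1Dr2 r1Mr2; rewrite /signless_laplacian_energy signless_laplacian_multipartite.
rewrite (perm_big _ (@eigenvalues_two_sizes _ _ _ c k0 p z m 1
  (m * z)%:R (p + m.-1 * z)%:R r1 r2 _ _ _ _ _ _ _ _)) //=.
- rewrite !big_cat !big_nseq !iter_addr_0 !big_cons big_nil /= mul1r.
  by rewrite addr0 !addrA -/avg.
- by rewrite r1Dr2 !(natrD, natrM) (predn_natr _ m_gt0); ring.
- by rewrite r1Mr2 !(natrD, natrM) (predn_natr _ m_gt0); ring.
Qed.

End MultipartiteGraph.

(** * The semi-dihedral group *)

Section SemidihedralGroup.
Local Open Scope nat_scope.
Local Open Scope group_scope.

(** The presentation alone only bounds the order from above. The semidirect product of the cyclic
    group of order 4n by the involution raising to the power 2n - 1 shows that 8n is attained. *)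
Lemma semidihedral_model (n : nat) : 0 < n ->
  exists (rT : finGroupType) (H : {group rT}), #|H| = (8 * n)%N /\ is_semidihedral n H.
Proof.
move=> n_gt0; pose q := (4 * n)%N; have q_gt1 : 1 < q by rewrite /q; lia.
exists (Extremal.gtype q 2 (2 * n - 1)), [set: _]%G.
split; first by rewrite Extremal.card // /q; lia.
suffices isoM : [set: Extremal.gtype q 2 (2 * n - 1)] \isog
    Grp (x : y : x ^+ q, y ^+ 2, x ^ y = x ^+ (2 * n - 1)).
  move=> rT H; rewrite isoM; apply: eq_existsb => [[x y]] /=; rewrite !xpair_eqE.
  congr (_ && _); congr (_ && _).
  (* As [y] is its own inverse, both conventions for conjugation give the same relation. *)
  apply: andb_id2l => /eqP y2; suff -> : x ^ y = y * x * y^-1 by [].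
  have yV : y^-1 = y by apply/eqP; rewrite eq_invg_mul -expg2 y2.
  by rewrite conjgE yV mulgA.
pose r := #[Zp1 : 'Z_q]; have rq : r = q by rewrite /r order_Zp1 Zp_cast.
have sqr1 : ((2 * n - 1) * (2 * n - 1))%:R%R = 1%R :> 'Z_r.
  have -> : ((2 * n - 1) * (2 * n - 1) = 1 + r * (n - 1))%N by rewrite rq /q; nia.
  by rewrite natrD natrM pchar_Zp ?rq // mul0r addr0.
have unitE : ((2 * n - 1)%:R%R : 'Z_r) \in GRing.unit.
  by apply/unitrPr; exists (2 * n - 1)%:R%R; rewrite -natrM.
pose u := FinRing.unit ('Z_r) unitE.
apply: Extremal.Grp => //; exists (Zp_unitm u).
rewrite Aut_aut order_injm ?injm_Zp_unitm ?in_setT //; split=> //.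
  by rewrite order_dvdn -val_eqE /= -natrM sqr1.
apply/eqP; rewrite autE ?cycle_id // eq_expg_mod_order /=.
by rewrite -/r val_Zp_nat ?rq // modn_mod.
Qed.

Lemma semidihedral_generators (n : nat) (gT : finGroupType) (G : {group gT}) :
  0 < n -> is_semidihedral n G ->
  exists x y, [/\ #[x] = (4 * n)%N, y ^+ 2 = 1, y \notin <[x]>,
    y * x = x ^+ (2 * n - 1) * y & G :=: <[x]> * <[y]>].
Proof.
move=> n_gt0 isoG; have [rT [H [oH isoH]]] := semidihedral_model n_gt0.
have oG : #|G| = (8 * n)%N.
  by rewrite -oH; apply/card_isog; rewrite isogEhom isoH -isoG homg_refl isoG -isoH homg_refl.
have /existsP[[x y] /= /eqP[defG x4n y2 yx]] := isoGrp_hom isoG.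
have {}yx : y * x = x ^+ (2 * n - 1) * y by rewrite -yx mulgKV.
have nxy : <[y]> \subset 'N(<[x]>).
  rewrite cycle_subG inE -cycleJ cycle_subG.
  have yV : y^-1 = y by apply/eqP; rewrite eq_invg_mul -expg2 y2.
  by rewrite conjgE yV mulgA yx -mulgA -expg2 y2 mulg1 mem_cycle.
rewrite norm_joinEr // in defG.
(* The orders are at most 4n and 2, and their product is at least 8n: equality holds throughout. *)
have cardM : (#[x] * #[y])%N = (8 * n * #|<[x]> :&: <[y]>|)%N.
  by rewrite -oG -defG !orderE mul_cardG.
have ox : #[x] <= 4 * n by rewrite dvdn_leq ?muln_gt0 ?n_gt0 // order_dvdn x4n.
have oy : #[y] <= 2 by rewrite dvdn_leq // order_dvdn y2.
have I0 : 0 < #|<[x]> :&: <[y]>| by apply: cardG_gt0.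
have {}ox : #[x] = (4 * n)%N.
  apply/eqP; rewrite eqn_leq ox leqNgt; apply/negP => ox4.
  have := leq_mul ox4 oy; have := leq_mul (leqnn (8 * n)) I0; have := order_gt0 y; lia.
exists x, y; split => //; rewrite -cycle_subG; apply/negP => yx_sub.
by rewrite (setIidPr yx_sub) -orderE ox in cardM; have := order_gt0 y; nia.
Qed.

Lemma card_sub_val (T : finType) (A P : pred T) :
  #|[set v : {x | x \in A} | P (val v)]| = #|[set x in A | P x]|.
Proof.
rewrite -(card_imset _ val_inj); apply: eq_card => x; rewrite inE.
apply/imsetP/andP => [[v] | [Ax Px]]; first by rewrite inE => Pv ->; rewrite (valP v).
by exists (Sub x Ax); rewrite ?inE SubK.
Qed.

Section NonCommutingSemidihedral.
Local Open Scope nat_scope.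
Local Open Scope group_scope.
Variables (n m' z : nat) (gT : finGroupType) (G : {group gT}) (x y : gT).
Let m := m'.+1.
Hypotheses (m'_gt0 : 0 < m') (mz : (m * z = 4 * n)%N).
(** Since y x^i = x^((2n-1)i) y, this says that x^i commutes with [y] exactly when [m] divides
    [i]. *)
Hypothesis dvd_m : forall i, (4 * n %| (2 * n - 2) * i) = (m %| i).
Hypotheses (n_gt0 : 0 < n) (ox : #[x] = (4 * n)%N) (y2 : y ^+ 2 = 1).
Hypotheses (x'y : y \notin <[x]>) (yx : y * x = x ^+ (2 * n - 1) * y).
Hypothesis defG : G :=: <[x]> * <[y]>.

Let m_dvd : m %| 4 * n.
Proof. by rewrite -mz dvdn_mulr. Qed.

Let eq_expx i j : (x ^+ i == x ^+ j) = (i == j %[mod 4 * n]).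
Proof. by rewrite eq_expg_mod_order ox. Qed.

Let yxX i : y * x ^+ i = x ^+ ((2 * n - 1) * i) * y.
Proof.
elim: i => [|i IHi]; first by rewrite muln0 mulg1 mul1g.
by rewrite mulnS addnC expgD -mulgA -yx mulgA -IHi -mulgA -expgSr.
Qed.

Let eq_mod_dvd i j : (j + (2 * n - 1) * i == i + (2 * n - 1) * j %[mod 4 * n])
  = (i == j %[mod m]).
Proof.
(* The two sides differ by (2n - 2)(j - i); ordering [i] and [j] makes the truncated subtraction
   exact. *)
wlog le_ij : i j / i <= j.
  move=> IH; have [/IH // | /ltnW /IH] := leqP i j.
  by rewrite eq_sym => ->; rewrite eq_sym.
rewrite [RHS]eq_sym eq_sym !eqn_mod_dvd //; last by nia.
by rewrite -dvd_m; congr (_ %| _); nia.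
Qed.

Let in_cycle_xy i : x ^+ i * y \notin <[x]>.
Proof. by rewrite groupMl ?mem_cycle. Qed.

Let commute_x_xy i j : (x ^+ i * (x ^+ j * y) == x ^+ j * y * x ^+ i) = (m %| i).
Proof.
rewrite -[X in _ == X]mulgA yxX !mulgA (inj_eq (mulIg y)) -!expgD [i + j]addnC.
rewrite eq_expx eqn_modDl eq_sym; have := eq_mod_dvd i 0.
by rewrite muln0 addn0 add0n mod0n => ->.
Qed.

Let commute_xy_xy i j :
  (x ^+ i * y * (x ^+ j * y) == x ^+ j * y * (x ^+ i * y)) = (i == j %[mod m]).
Proof.
have xyxy a b : x ^+ a * y * (x ^+ b * y) = x ^+ (a + (2 * n - 1) * b).
  by rewrite mulgA -(mulgA _ y) yxX mulgA -expgD -mulgA -expg2 y2 mulg1.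
by rewrite !xyxy eq_expx eq_sym eq_mod_dvd.
Qed.

Let commute_x_x i j : x ^+ i * x ^+ j = x ^+ j * x ^+ i.
Proof. by rewrite -!expgD addnC. Qed.

Let sdP g : g \in G -> exists i, g = x ^+ i \/ g = x ^+ i * y.
Proof.
rewrite defG => /mulsgP[_ _ /cycleP[i ->] /cycleP[j ->] ->]; exists i.
have -> : y ^+ j = y ^+ odd j.
  by rewrite -{1}(odd_double_half j) -mul2n expgD expgM y2 expg1n mulg1.
by case: (odd j); [right | left; rewrite mulg1].
Qed.

Let Gx i : x ^+ i \in G.
Proof. by rewrite defG -[x ^+ i]mulg1 mem_mulg ?mem_cycle. Qed.

Let Gxy i : x ^+ i * y \in G.
Proof. by rewrite defG mem_mulg ?mem_cycle ?cycle_id. Qed.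

Let center_x i : (x ^+ i \in 'Z(G)) = (m %| i).
Proof.
apply/centerP/idP => [[_ /(_ _ (Gxy 0))/eqP] | m_i]; first by rewrite commute_x_xy.
split=> // g /sdP[j [] ->]; first exact: commute_x_x.
by apply/eqP; rewrite commute_x_xy.
Qed.

Let center_xy i : x ^+ i * y \notin 'Z(G).
Proof.
apply/negP => /centerP[_ /(_ _ (Gx 1))/esym/eqP].
by rewrite commute_x_xy dvdn1 eqSS; case: m' m'_gt0.
Qed.

(** Rotations go to [None], and x^i y goes to [i] modulo [m], which labels its coset of the centre.
    The exponent found by [pick] is determined modulo 4n, hence modulo the divisor [m]. *)
Definition sd_class (g : gT) : option 'I_m :=
  if g \in <[x]> then None
  else omap (fun i : 'I_(4 * n) => inZp i) [pick i : 'I_(4 * n) | x ^+ i * y == g].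

Let sd_class_x i : sd_class (x ^+ i) = None.
Proof. by rewrite /sd_class mem_cycle. Qed.

Let sd_class_xy i : sd_class (x ^+ i * y) = Some (inZp i).
Proof.
rewrite /sd_class (negPf (in_cycle_xy i)); case: pickP => [j | no_j] /=.
  rewrite (inj_eq (mulIg y)) eq_expx => /eqP e; congr Some.
  by apply: val_inj; rewrite /= -(modn_dvdm j m_dvd) e modn_dvdm.
have lt_i : i %% (4 * n) < 4 * n by rewrite ltn_mod; lia.
by have := no_j (Ordinal lt_i); rewrite /= (inj_eq (mulIg y)) eq_expx modn_mod eqxx.
Qed.

(** A rotation commuting with some reflection is central, so it is not a vertex. *)
Lemma sd_class_adj (v w : nc_vertex G) :
  nc_adj v w = (sd_class (val v) != sd_class (val w)).
Proof.
rewrite /nc_adj; case: v w => [g /= /setDP[Gg Z'g]] [h /= /setDP[Gh Z'h]].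
have [i [] eg] := sdP Gg; have [j [] eh] := sdP Gh; subst g h.
- by rewrite !sd_class_x commute_x_x !eqxx.
- by rewrite sd_class_x sd_class_xy commute_x_xy -center_x Z'g.
- by rewrite sd_class_x sd_class_xy eq_sym commute_x_xy -center_x Z'h.
- by rewrite !sd_class_xy commute_xy_xy.
Qed.

Lemma partsize_sd_rot :
  partsize (fun v : nc_vertex G => sd_class (val v)) None = (4 * n - z)%N.
Proof.
rewrite /partsize (card_sub_val _ [pred g | sd_class g == None]).
have -> : [set g in (G :\: 'Z(G))%g | sd_class g == None] = <[x]> :\: <[x ^+ m]>.
  apply/setP => g; rewrite inE !in_setD /=; apply/andP/andP.
    case=> /andP[Z'g /sdP[i [] eg]]; subst g; last by rewrite sd_class_xy.
    rewrite mem_cycle; split=> //; apply: contra Z'g => /cycleP[k ->].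
    by rewrite -expgM center_x dvdn_mulr.
  case=> Z'g /cycleP[i eg]; subst g; rewrite sd_class_x eqxx Gx andbT center_x.
  by split=> //; apply: contra Z'g => /dvdnP[k ->]; rewrite mulnC expgM mem_cycle.
rewrite cardsD (setIidPr _) ?cycle_subG ?mem_cycle // -!orderE orderXdiv ox -mz ?dvdn_mulr //.
by rewrite mulKn.
Qed.

Lemma partsize_sd_refl k : k != None ->
  partsize (fun v : nc_vertex G => sd_class (val v)) k = z.
Proof.
case: k => // k _; rewrite /partsize (card_sub_val _ [pred g | sd_class g == Some k]).
have -> : [set g in (G :\: 'Z(G))%g | sd_class g == Some k]
    = [set x ^+ (k + m * j) * y | j : 'I_z].
  apply/setP => g; rewrite inE in_setD /=; apply/andP/imsetP.
    case=> /andP[Z'g /sdP[i [] eg]]; subst g; first by rewrite sd_class_x.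
    rewrite sd_class_xy => /eqP[ik].
    (* The index [j] is the quotient of the reduced exponent by [m], and [k] is its remainder. *)
    have lt_i : i %% (4 * n) %/ m < z.
      by rewrite ltn_divLR // [(z * _)%N]mulnC mz ltn_mod; lia.
    exists (Ordinal lt_i) => //=; congr (_ * y); apply/eqP; rewrite eq_expx -ik /=.
    by rewrite -(modn_dvdm i m_dvd) addnC [(m * _)%N]mulnC -divn_eq modn_mod.
  case=> j _ ->; rewrite center_xy Gxy sd_class_xy; split => //; apply/eqP; congr Some.
  by apply: val_inj; rewrite /= addnC mulnC modnMDl modn_small.
rewrite card_imset ?card_ord // => i j /mulIg/eqP; rewrite eq_expx -mz.
have lt_small (a : 'I_z) : k + m * a < m * z.
  by have := ltn_ord a; have := ltn_ord k; rewrite -/m; nia.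
by rewrite !modn_small // eqn_add2l eqn_pmul2l // => /eqP /val_inj.
Qed.

End NonCommutingSemidihedral.
End SemidihedralGroup.

(** * Comparison of the energies *)

Section EnergyInequalities.
Variables (F : realFieldType) (M Z d : F).

(* With [m] parts of size [z] and one part of size [(m - 1) * z], these are
   [M = m], [Z = z], and [d] is the average degree. *)
Definition sd_sizes :=
  [/\ 2 <= Z, (M = 3 /\ 3 <= Z) \/ (M = 4) \/ 5 <= M
    & d * (2 * M - 1) = 3 * M * (M - 1) * Z].

Let P := (M - 1) * Z.

(** [M * Z] and [2 * P] are the two vertex degrees, and the average lies between them. *)
Let sizesP : sd_sizes -> [/\ 3 <= M, M * Z <= d & d <= 2 * P].
Proof.
move=> [Z2 M3 dE]; have {}M3 : 3 <= M by move: M3 => [[-> _] | [-> | ]]; lra.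
have M'_gt0 : 0 < 2 * M - 1 by lra.
split=> //; rewrite -(ler_pM2r M'_gt0) dE /P.
  by have : 0 <= M * Z * (M - 2) by [rewrite !mulr_ge0 //; lra]; lra.
by have : 0 <= (M - 1) * Z * (M - 2) by [rewrite !mulr_ge0 //; lra]; lra.
Qed.

(** This puts the average degree between the two roots of the quadratic for Q, whose sum is
    [3 * P + M * Z] and whose difference is at least [2 * P]. *)
Lemma avg_degree_gap : sd_sizes -> `|2 * d - (3 * P + M * Z)| <= 2 * P.
Proof.
move=> sizes; have [M3 d_ge d_le] := sizesP sizes; case: sizes => Z2 _ _.
by move: d_le; rewrite ler_norml /P => d_le; apply/andP; split; nra.
Qed.

(** The right side bounds LE+ from below: [2 * P] replaces the square root and the nonnegative term
    with [M - 1] copies is dropped. *)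
Lemma complete_lt_signless : sd_sizes ->
  2 * (P + M * Z - 1) < `|M * Z - d| * (P - 1) + `|2 * P - d| * (M * (Z - 1)) + 2 * P.
Proof.
move=> sizes; have [M3 d_ge d_le] := sizesP sizes; case: sizes => Z2 M345 dE.
rewrite ler0_norm ?subr_le0 // ger0_norm ?subr_ge0 //.
have M'_gt0 : 0 < 2 * M - 1 by lra.
(* This is the claim multiplied by [2 * M - 1], with [d] eliminated. For M = 3 it fails at Z = 2 and
   becomes 80 < 81 at Z = 3, whence the condition in [sd_sizes]. *)
have key : 2 * (M * Z - 1) * (2 * M - 1) < M * (M - 2) * Z * (2 * Z * (M - 1) - M).
  case: M345 => [[-> Z3] | M45]; first by nra.
  have {M45} M4 : 4 <= M by case: M45 => [-> | ]; lra.
  have MZ0 : 0 < M * Z by rewrite mulr_gt0; lra.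
  have h : 2 * (2 * M - 1) <= (M - 2) * (2 * Z * (M - 1) - M).
    have : 0 <= (M - 2) * (M - 1) * (Z - 2) by rewrite !mulr_ge0 //; lra.
    by have : 0 <= (M - 4) * (3 * M - 2) by [rewrite mulr_ge0 //; lra]; lra.
  have := ler_wpM2l (ltW MZ0) h; lra.
rewrite -(ltr_pM2r M'_gt0) -subr_gt0.
suff -> : ((- (M * Z - d) * (P - 1) + (2 * P - d) * (M * (Z - 1)) + 2 * P) * (2 * M - 1) -
   2 * (P + M * Z - 1) * (2 * M - 1)) =
   M * (M - 2) * Z * (2 * Z * (M - 1) - M) - 2 * (M * Z - 1) * (2 * M - 1) by rewrite subr_gt0.
(* Collects [d] into the product [d * (2 * M - 1)], so that [dE] can be rewritten. *)
have E a b c e f : (- (a - d) * b + (c - d) * e + f) * (2 * M - 1) =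
   (b - e) * (d * (2 * M - 1)) + (c * e + f - a * b) * (2 * M - 1) by ring.
by rewrite E dE /P; ring.
Qed.

(** The terms shared by LE and LE+ are removed and the square root is replaced by its upper bound
    [3 * P]. *)
Lemma signless_lt_laplacian : sd_sizes ->
  `|2 * P - Z - d| * (M - 1) + 3 * P < `|P + M * Z - d| * M + `|d|.
Proof.
move=> sizes; have [M3 d_ge d_le] := sizesP sizes; case: sizes => Z2 M345 dE.
have MZ0 : 0 < M * Z by rewrite mulr_gt0; lra.
rewrite [`|d|]ger0_norm ?(ger0_norm (_ : 0 <= P + M * Z - d)); try by move: d_le; rewrite /P; lra.
(* The sign of [2 * P - Z - d] is that of M(M - 5) + 3: negative for M = 3, 4 and positive from 5
   on. In the last case [d] cancels and the gap is [M * Z]. *)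
case: M345 => [[M3' _] | [M4 | M5]].
- have d3 : d = 18 / 5 * Z by move: dE; rewrite M3'; lra.
  by rewrite /P M3' d3 ler0_norm; lra.
- have d4 : d = 36 / 7 * Z by move: dE; rewrite M4; lra.
  by rewrite /P M4 d4 ler0_norm; lra.
rewrite ger0_norm; first by rewrite /P; lra.
have M'_gt0 : 0 < 2 * M - 1 by lra.
rewrite -(pmulr_lge0 _ M'_gt0) mulrBl dE /P.
have : 0 <= Z * (M * (M - 5) + 3).
  by rewrite mulr_ge0 ?addr_ge0 ?mulr_ge0 //; lra.
by lra.
Qed.

End EnergyInequalities.

(** The hypothesis places [d] between the roots (a - s)/2 and (a + s)/2, so the distances to [d] add
    up to the distance [s] of the roots. *)
Lemma norm_roots_sum (C : numClosedFieldType) (a s d : C) :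
  2 * d - a \is Num.real -> `|2 * d - a| <= s ->
  `|(a + s) / 2 - d| + `|(a - s) / 2 - d| = s.
Proof.
move=> u_real; rewrite real_ler_norml // => /andP[us su].
have -> : (a + s) / 2 - d = (s - (2 * d - a)) / 2 by field.
have -> : (a - s) / 2 - d = - (s + (2 * d - a)) / 2 by field.
rewrite [X in X + _]ger0_norm ?ler0_norm; first by field.
  by rewrite mulNr oppr_le0 mulr_ge0 ?invr_ge0 ?ler0n // addrC -lerBlDr sub0r.
by rewrite mulr_ge0 ?invr_ge0 ?ler0n // subr_ge0.
Qed.

Lemma sqrtC_bounds (C : numClosedFieldType) (a b n : nat) :
  (a ^ 2 <= n)%N -> (n <= b ^ 2)%N -> a%:R <= sqrtC (n%:R : C) <= b%:R.
Proof.
move=> an nb; have sqrtX k : k%:R = sqrtC (k ^ 2)%:R :> C by rewrite natrX sqrCK ?ler0n.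
by rewrite (sqrtX a) (sqrtX b) !ler_sqrtC ?nnegrE ?ler0n // !ler_nat an nb.
Qed.

(** * Energies of the complete graph *)

Section CompleteGraph.
Variables (C : numClosedFieldType) (m : nat).
Hypothesis m_gt0 : (0 < m)%N.

Let part (x : vertex (complete_graph m.+1)) : 'I_m.+1 := x.

Let adj_part x y : adj x y = (part x != part y).
Proof. by []. Qed.

Let size_part k : partsize part k = 1%N.
Proof. by rewrite /partsize -(cards1 k); apply: eq_card => i; rewrite !inE. Qed.

Let avg_complete : average_degree C (complete_graph m.+1) = m%:R.
Proof.
rewrite /average_degree (@edges_multipartite _ 'I_m.+1 part ord0 1 1 m) ?card_ord //.
rewrite /nverts card_ord !muln1 mul1n add1n prednK //.
by rewrite -mulnS natrM mulfK // pnatr_eq0.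
Qed.

Lemma energy_complete : energy C (complete_graph m.+1) = (2 * m)%:R.
Proof.
rewrite (@energy_multipartite C _ 'I_m.+1 part ord0 1 1 m _ _ _ _ _ _ _ m%:R (-1)) ?card_ord //.
- by rewrite normrN1 normr_nat muln1 -addrA natr1 -natrD; congr _%:R; lia.
- by rewrite muln1 predn_natr.
- by rewrite !muln1 mulrN1.
Qed.

Lemma laplacian_energy_complete :
  laplacian_energy C (complete_graph m.+1) = (2 * m)%:R.
Proof.
rewrite (@laplacian_energy_multipartite C _ 'I_m.+1 part ord0 1 1 m) ?card_ord //.
rewrite avg_complete /nverts card_ord /= muln0 !mulr0n !add0r.
by rewrite -natrB // subSnn normr1 normr_nat -natrD; congr _%:R; lia.
Qed.

Lemma signless_laplacian_energy_complete :
  signless_laplacian_energy C (complete_graph m.+1) = (2 * m)%:R.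
Proof.
rewrite (@signless_laplacian_energy_multipartite C _ 'I_m.+1 part ord0 1 1 m
  _ _ _ _ _ _ _ (2 * m)%:R (m%:R - 1)) ?card_ord //.
- rewrite avg_complete muln0 !mulr0n !add0r muln1 add1n prednK //.
  have -> : m%:R - 1 - m%:R = -1 :> C by ring.
  rewrite normrN1 -natrB; last by lia.
  by rewrite normr_nat -natrD natr1; congr _%:R; lia.
- by rewrite natrM; ring.
- by rewrite natrM; ring.
Qed.

End CompleteGraph.

(** * Energies when the large part has size (m - 1)z *)

Section TwoSizesEnergies.
Variables (C : numClosedFieldType) (g : sgraph) (K : finType).
Variables (c : vertex g -> K) (k0 : K) (m z : nat).
Hypothesis adj_c : forall x y, adj x y = (c x != c y).
Hypotheses (z_ge2 : (2 <= z)%N) (m_size : [\/ m = 3 /\ (3 <= z)%N, m = 4 | (5 <= m)%N]).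
Hypotheses (cardK : #|K| = m.+1) (size_k0 : partsize c k0 = (m.-1 * z)%N).
Hypothesis size_k : forall k, k != k0 -> partsize c k = z.

Let m_ge3 : (3 <= m)%N. Proof. by case: m_size => [[-> _] | -> |]; lia. Qed.
Let m_gt0 : (0 < m)%N. Proof. by lia. Qed.
Let z_gt0 : (0 < z)%N. Proof. by lia. Qed.
Let p_gt0 : (0 < m.-1 * z)%N. Proof. by rewrite muln_gt0 z_gt0; lia. Qed.

(** The inequalities are proved over an ordered field, whereas [C] is only partially ordered; all
    terms but the square roots are rational and are transported by [ratr]. *)
Let M : rat := m%:R.
Let Z : rat := z%:R.
Let P := (M - 1) * Z.
Let D := 3 * M * (M - 1) * Z / (2 * M - 1).

Let sizes : sd_sizes M Z D.
Proof.
have M3 : 3 <= M by rewrite (ler_nat _ 3).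
split; first by rewrite (ler_nat _ 2).
  rewrite /M /Z; case: m_size => [[-> z3] | -> | m5].
  - by left; rewrite (ler_nat _ 3).
  - by right; left.
  - by right; right; rewrite (ler_nat _ 5).
by rewrite /D divfK //; lra.
Qed.

Let ratrM : ratr M = m%:R :> C. Proof. exact: ratr_nat. Qed.
Let ratrZ : ratr Z = z%:R :> C. Proof. exact: ratr_nat. Qed.
Let ratrP : ratr P = (m.-1 * z)%:R :> C.
Proof. by rewrite /P rmorphM rmorphB rmorph1 /= ratrM ratrZ natrM predn_natr. Qed.

Let nverts_g : nverts g = (m.-1 * z + m * z)%N.
Proof. exact: nverts_multipartite cardK size_k0 size_k. Qed.

Let avgE : average_degree C g = ratr D.
Proof.
rewrite /average_degree (edges_multipartite adj_c p_gt0 z_gt0 m_gt0 cardK size_k0 size_k).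
rewrite nverts_g /D fmorph_div !rmorphM !rmorphB !rmorphM rmorph1 /= !ratr_nat.
rewrite !(natrD, natrM) (predn_natr _ m_gt0).
have z0 : z%:R != 0 :> C by rewrite pnatr_eq0 -lt0n.
have m'0 : 2 * m%:R - 1 != 0 :> C.
  by rewrite subr_eq0 -natrM (eqr_nat _ _ 1); lia.
have d0 : (m%:R - 1) * z%:R + m%:R * z%:R != 0 :> C.
  have -> : (m%:R - 1) * z%:R + m%:R * z%:R = (2 * m%:R - 1) * z%:R :> C by ring.
  by rewrite mulf_neq0.
by field; rewrite m'0.
Qed.

Let norm_avg (q x : rat) : q = x - D -> `|ratr x - average_degree C g| = ratr `|q| :> C.
Proof. by move=> ->; rewrite avgE -rmorphB ratr_norm. Qed.

Let ratr_muln (q : rat) k : ratr q *+ k = ratr (q * k%:R) :> C.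
Proof. by rewrite rmorphM /= ratr_nat mulr_natr. Qed.

Let A := `|M * Z - D| * (P - 1) + `|2 * P - D| * (M * (Z - 1)).

Let ratrMZ : ratr (M * Z) = (m * z)%:R :> C.
Proof. by rewrite rmorphM natrM /= ratrM ratrZ. Qed.

Let ratr2P : ratr (2 * P) = (m.-1 * z + m.-1 * z)%:R :> C.
Proof. by rewrite rmorphM natrD /= ratrP ratr_nat mulr_natl. Qed.

Let common_terms :
  `|(m * z)%:R - average_degree C g| *+ (m.-1 * z).-1
  + `|(m.-1 * z + m.-1 * z)%:R - average_degree C g| *+ (m * z.-1) = ratr A.
Proof.
rewrite -ratrMZ -ratr2P (norm_avg erefl) (norm_avg erefl) !ratr_muln -rmorphD /A.
by rewrite natrM !predn_natr // natrM predn_natr.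
Qed.

Lemma laplacian_energy_sd :
  laplacian_energy C g = ratr (A + (`|P + M * Z - D| * M + `|D|)).
Proof.
rewrite (laplacian_energy_multipartite C adj_c p_gt0 z_gt0 m_gt0 cardK size_k0 size_k).
rewrite common_terms nverts_g natrD -ratrP -ratrMZ -rmorphD (norm_avg erefl) ratr_muln.
by rewrite avgE -ratr_norm -!rmorphD addrA.
Qed.

(** Square root of the discriminant of the quadratic for Q, hence the difference of its roots. *)
Let S2 : C := sqrtC (z ^ 2 + 8 * (m.-1 * z) ^ 2)%:R.

Let S2_bounds : ratr (2 * P) <= S2 <= ratr (3 * P).
Proof.
rewrite ratr2P rmorphM /= ratrP ratr_nat -natrM; apply: sqrtC_bounds; first by nia.
(* With p = (m - 1)z at least z, the radicand is at most 9p^2. *)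
have : (z <= m.-1 * z)%N by rewrite leq_pmull; lia.
by nia.
Qed.

Lemma signless_laplacian_energy_sd :
  signless_laplacian_energy C g = ratr (A + `|2 * P - Z - D| * (M - 1)) + S2.
Proof.
pose a : C := ratr (3 * P + M * Z).
have aE : a = 3 * (m.-1 * z)%:R + (m * z)%:R.
  by rewrite /a rmorphD rmorphM /= ratrP ratrMZ ratr_nat.
have S2E : S2 ^+ 2 = z%:R ^+ 2 + 8 * (m.-1 * z)%:R ^+ 2.
  by rewrite /S2 sqrtCK !(natrD, natrM, natrX).
have m1 := predn_natr C m_gt0.
rewrite (signless_laplacian_energy_multipartite (r1 := (a + S2) / 2) (r2 := (a - S2) / 2)
  adj_c p_gt0 z_gt0 m_gt0 cardK size_k0 size_k).
- rewrite common_terms -[LHS]addrA norm_roots_sum.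
  + by rewrite -ratr2P -ratrZ -rmorphB (norm_avg erefl) ratr_muln predn_natr // -rmorphD.
  + have -> : 2 * average_degree C g - a = ratr (2 * D - (3 * P + M * Z)).
      by rewrite avgE rmorphB (rmorphM _ 2 D) /= ratr_nat.
    by rewrite realE ler0q lerq0 le_total.
  have -> : 2 * average_degree C g - a = ratr (2 * D - (3 * P + M * Z)).
    by rewrite avgE rmorphB (rmorphM _ 2 D) /= ratr_nat.
  case/andP: S2_bounds => le_S2 _; rewrite -ratr_norm; apply: le_trans le_S2.
  by rewrite ler_rat avg_degree_gap.
- by rewrite aE !natrM m1; field.
have -> : (a + S2) / 2 * ((a - S2) / 2) = (a ^+ 2 - S2 ^+ 2) / 4 by field.
by rewrite S2E aE !natrM m1; field.
Qed.

Let S1 : C := sqrtC ((m.-1 * z) ^ 2 + 4 * (m * z) * (m.-1 * z))%:R.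

Lemma energy_sd : energy C g = (m.-1 * z)%:R + S1.
Proof.
have /andP[S1_ge _] : (m.-1 * z)%:R <= S1 <= (m.-1 * z + 2 * (m * z))%:R.
  by apply: sqrtC_bounds; nia.
have S1E : S1 ^+ 2 = (m.-1 * z)%:R ^+ 2 + 4 * (m * z)%:R * (m.-1 * z)%:R.
  by rewrite /S1 sqrtCK !(natrD, natrM, natrX).
have m1 := predn_natr C m_gt0.
set a : C := (m.-1 * z)%:R in S1_ge S1E *.
(* [norm_roots_sum] is used with [d] equal to 0, as the roots have opposite signs. *)
have aN : 2 * 0 - a = - a by rewrite mulr0 sub0r.
rewrite (energy_multipartite (r1 := (a + S1) / 2) (r2 := (a - S1) / 2)
  adj_c p_gt0 z_gt0 m_gt0 cardK size_k0 size_k) -/a.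
- rewrite -addrA -[X in `|X| + _]subr0 -[X in _ + (_ + `|X|)]subr0 norm_roots_sum //.
    by rewrite aN rpredN realn.
  by rewrite aN normrN normr_nat.
- by field.
have -> : (a + S1) / 2 * ((a - S1) / 2) = (a ^+ 2 - S1 ^+ 2) / 4 by field.
by rewrite S1E natrM -/a; field.
Qed.

Let N1 := (m.-1 * z + m * z - 1)%N.
Let N1_gt0 : (0 < N1)%N. Proof. by rewrite /N1; nia. Qed.
Let nvertsE : nverts g = N1.+1.
Proof. by rewrite nverts_g /N1; lia. Qed.

Lemma energies_sd :
  [/\ energy C g < signless_laplacian_energy C g < laplacian_energy C g,
      ~~ hypoenergetic C g /\ ~~ hyperenergetic C g
    & Q_hyperenergetic C g /\ L_hyperenergetic C g].
Proof.
(* The lower bound gives E at least the number N of vertices; the upper bound is chosen so that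
   adding (m - 1)z yields exactly 2(N - 1). *)
have /andP[S1_ge S1_le] : (m * z)%:R <= S1 <= (m.-1 * z + 2 * (m * z) - 2)%:R.
  by apply: sqrtC_bounds; nia.
have /andP[S2_ge S2_le] := S2_bounds.
have E_le : energy C g <= (2 * N1)%:R.
  rewrite energy_sd; apply: le_trans (lerD (lexx _) S1_le) _.
  by rewrite -natrD ler_nat /N1; lia.
have Q_gt : (2 * N1)%:R < signless_laplacian_energy C g.
  rewrite signless_laplacian_energy_sd; apply: lt_le_trans (lerD (lexx _) S2_ge).
  have -> : (2 * N1)%:R = ratr (2 * (P + M * Z - 1)) :> C.
    rewrite rmorphM rmorphB (rmorphD _ P) rmorph1 /= ratrP ratrMZ ratr_nat.
    by rewrite natrM -natrD natrB //; nia.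
  rewrite -rmorphD ltr_rat; apply: lt_le_trans (complete_lt_signless sizes) _.
  rewrite -/P -/A lerD2r lerDl mulr_ge0 // subr_ge0 (ler_nat _ 1); lia.
have L_gt : signless_laplacian_energy C g < laplacian_energy C g.
  rewrite signless_laplacian_energy_sd laplacian_energy_sd.
  apply: le_lt_trans (lerD (lexx _) S2_le) _.
  by rewrite -rmorphD ltr_rat -addrA ltrD2l signless_lt_laplacian.
rewrite /hypoenergetic /hyperenergetic /Q_hyperenergetic /L_hyperenergetic nvertsE.
rewrite (energy_complete C N1_gt0) (laplacian_energy_complete C N1_gt0).
rewrite (signless_laplacian_energy_complete C N1_gt0).
split; first by apply/andP; split; [apply: le_lt_trans E_le Q_gt | apply: L_gt].
  rewrite (le_gtF E_le) le_gtF; first by split.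
  by rewrite -nvertsE nverts_g natrD energy_sd lerD2l.
split; [exact: Q_gt | exact: lt_trans Q_gt L_gt].
Qed.

End TwoSizesEnergies.

(* [m] is the order of [a] modulo the centre of [SD_8n], and [z] that of the centre. *)
Lemma semidihedral_center_index (n : nat) : (1 < n)%N ->
  exists m z, [/\ (m * z = 4 * n)%N, (2 <= z)%N,
    [\/ m = 3 /\ (3 <= z)%N, m = 4 | (5 <= m)%N]
    & forall i, (4 * n %| (2 * n - 2) * i)%N = (m %| i)%N].
Proof.
move=> n_gt1; have nE := odd_double_half n; rewrite -mul2n in nE.
case n_odd : (odd n) nE => nE; set k := n./2 in nE.
  (* For n = 2k + 1 the centre has order 4: 2n - 2 = 4k, and k is coprime to n. *)
  exists n, 4; split=> // [|| i]; first by lia.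
    have [n3 | n_neq3] := eqVneq n 3; first by apply: Or31; rewrite n3.
    by apply: Or33; lia.
  have -> : ((2 * n - 2) * i = 4 * (k * i))%N by lia.
  rewrite dvdn_pmul2l // Gauss_dvdr // coprime_sym /coprime -nE addnC.
  by rewrite gcdnMDl gcdn1.
(* For n even the centre has order 2, since n - 1 is odd and coprime to n, hence coprime to 2n. *)
exists (2 * n)%N, 2; split=> // [|| i]; first by lia.
  have [n2 | n_neq2] := eqVneq n 2; first by apply: Or32; rewrite n2.
  by apply: Or33; lia.
have -> : ((2 * n - 2) * i = 2 * (n.-1 * i))%N by lia.
have -> : (4 * n = 2 * (2 * n))%N by lia.
rewrite dvdn_pmul2l // Gauss_dvdr // coprimeMl coprime2n.
by rewrite -{2}(prednK (ltnW n_gt1)) coprimeSn andbT; lia.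
Qed.

Theorem theorem5p10 (C : numClosedFieldType) (n : nat) (n_gt1 : (1 < n)%N)
    (gT : finGroupType) (G : {group gT}) (sdG : is_semidihedral n G) :
  let Gamma := noncommuting_graph G in
  [/\ energy C Gamma < signless_laplacian_energy C Gamma
        < laplacian_energy C Gamma,
      ~~ hypoenergetic C Gamma /\ ~~ hyperenergetic C Gamma
    & Q_hyperenergetic C Gamma /\ L_hyperenergetic C Gamma].
Proof.
have n_gt0 : (0 < n)%N by lia.
have [x [y [ox y2 x'y yx defG]]] := semidihedral_generators n_gt0 sdG.
have [[|m'] [z [mz z_ge2 m_size dvd_m]]] := semidihedral_center_index n_gt1; first by lia.
have m'_gt0 : (0 < m')%N by case: m_size; lia.
apply: (@energies_sd C (noncommuting_graph G) _
  (fun v => sd_class n m' x y (val v)) None m'.+1 z) => //.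
- exact: (sd_class_adj m'_gt0 mz dvd_m n_gt0 ox y2 x'y yx defG).
- by rewrite card_option card_ord.
- rewrite (partsize_sd_rot m'_gt0 mz dvd_m n_gt0 ox y2 x'y yx defG) -mz.
  by rewrite mulSn addKn.
- exact: (partsize_sd_refl m'_gt0 mz dvd_m n_gt0 ox y2 x'y yx defG).
Qed.
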